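(* Let $a,k,r$ be positive integers with $r<a$ and $k\ge3$. The subtraction game $\mathcal{S}(a,ka+r,(k+4)a+r)$ is periodic with period $2ka+4a+2r$ and nim-sequence \[\big((0^a1^a)^{k/2}0^r2^{a-r}1^r\big)^2\,3^{a-r}0^r2^{a-r}1^r\ \text{ if $k$ is even},\qquad \big((0^a1^a)^{(k+1)/2}2^r\big)^2\,0^{a-r}3^r1^{a-r}2^r\ \text{ if $k$ is odd}.\] Moreover, in both cases the subtraction set has expansion $\{a,\,ka+r,\,(k+2)a+r,\,(k+4)a+r,\,(2k+3)a+2r\}^{*(2ka+4a+2r)}$.
   Context: For a finite set $S$ of positive integers, the subtraction game $\mathcal{S}(S)$ is played on a single pile: two players alternately remove $s\in S$ coins (at most the pile size); the last mover wins. The nim-value is $\mathcal{G}(n)=\operatorname{mex}\{\mathcal{G}(n-s): s\in S, s\le n\}$. Words of single digits are written by juxtaposition, and $x^m$ denotes $m$-fold repetition of the block $x$. ''The game is periodic with period $p$ and nim-sequence $W$'' ($W$ a word of length $p$) means $\mathcal{G}(n+p)=\mathcal{G}(n)$ for all $n\ge0$, $p$ is the least such, and $\mathcal{G}(n)$ is the $((n\bmod p)+1)$-st letter of $W$ for all $n\ge0$. The expansion of $S$ is $S^{ex}=\{s\ge1:\mathcal{G}(n+s)\ne\mathcal{G}(n)\ \forall n\ge0\}$; ''has expansion $T$'' means $S^{ex}=T$. For a set $X$ and $p\ge1$, $X^{*p}=\{x+mp:x\in X,m\ge0\}$. *)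

(* Defs.v *)
From mathcomp Require Import all_boot.

Set Implicit Arguments.
Unset Strict Implicit.
Unset Printing Implicit Defensive.

(* The search range is long enough: the numbers 0, ..., size s cannot all
   occur in s (see mexP). *)
Definition mex (s : seq nat) : nat :=
  find (fun m => m \notin s) (iota 0 (size s).+1).

Lemma mexP (s : seq nat) : mex s \notin s /\ (forall m, m < mex s -> m \in s).
Proof.
have hs : has (fun m => m \notin s) (iota 0 (size s).+1).
  rewrite has_predC; apply/negP => /allP sub.
  have := uniq_leq_size (iota_uniq 0 (size s).+1) sub.
  by rewrite size_iota ltnn.
have lt_mex : mex s < (size s).+1 by rewrite -[X in _ < X](size_iota 0) -has_find.
split; first by have := nth_find 0 hs; rewrite nth_iota.
move=> m lt_m; have := before_find 0 lt_m.
by rewrite nth_iota ?(ltn_trans lt_m) // => /negbFE.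
Qed.

(* A subtraction set is a list of positive integers; order and repetitions are
   irrelevant. [nim_values S n] lists the nim-values of the piles
   0, ..., n - 1; grundyE below is the usual recursion. *)
Fixpoint nim_values (S : seq nat) (n : nat) : seq nat :=
  if n is m.+1 then
    let w := nim_values S m in
    rcons w (mex [seq nth 0 w (m - s) | s <- S & s <= m])
  else [::].

Definition grundy (S : seq nat) (n : nat) : nat := nth 0 (nim_values S n.+1) n.

Lemma size_nim_values S n : size (nim_values S n) = n.
Proof. by elim: n => //= n IHn; rewrite size_rcons IHn. Qed.

Lemma nth_nim_values S n i : i < n -> nth 0 (nim_values S n) i = grundy S i.
Proof.
elim: n => // n IHn; rewrite ltnS leq_eqVlt => /orP[/eqP-> // | lt_in].
by rewrite /= nth_rcons size_nim_values lt_in IHn.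
Qed.

Lemma grundyE S n : all (leq 1) S ->
  grundy S n = mex [seq grundy S (n - s) | s <- S & s <= n].
Proof.
move=> /allP S_gt0; rewrite /grundy /= nth_rcons size_nim_values ltnn eqxx.
congr mex; apply/eq_in_map => s; rewrite mem_filter => /andP[le_sn /S_gt0 s_gt0].
by apply: nth_nim_values; rewrite ltn_subrL s_gt0 (leq_trans s_gt0).
Qed.

(* m-fold repetition of a block; the power c^m of a letter is [nseq m c]. *)
Definition wpow (w : seq nat) (m : nat) : seq nat := flatten (nseq m w).

Definition is_period (f : nat -> nat) (p : nat) : Prop :=
  0 < p /\ (forall n, f (n + p) = f n).

Definition is_least_period (f : nat -> nat) (p : nat) : Prop :=
  is_period f p /\ (forall q, is_period f q -> p <= q).

Definition periodic_with (S : seq nat) (p : nat) (W : seq nat) : Prop :=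
  [/\ size W = p,
      is_least_period (grundy S) p
    & forall n, grundy S n = nth 0 W (n %% p)].

Definition in_expansion (S : seq nat) (s : nat) : Prop :=
  0 < s /\ (forall n, grundy S (n + s) <> grundy S n).

Definition has_expansion (S : seq nat) (T : nat -> Prop) : Prop :=
  forall s, in_expansion S s <-> T s.

(* X^{*p} *)
Definition star (X : nat -> Prop) (p s : nat) : Prop :=
  exists x m, X x /\ s = x + m * p.

(* Main.v *)
(** Write M = (k+2)a + r, so the period is 2M. Coordinates n = hM + qa + t, with
    0 <= qa + t < M and t < a, make the nim-value a function [cell] of the
    parity of h, of q, and of whether t < r. As ka + r = M - 2a and
    (k+4)a + r = M + 2a, the moves act simply on (h, q, t), and the mex rule
    becomes a finite case check. Modulo 2M the claimed expansion is
    {±a, M, M ± 2a}: it is closed under negation, so the shifts a, M and M - 2a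
    have to be shown never to preserve a value, and for every other s <= M one
    exhibits n with equal values at n and n + s. The period is least because a
    period of nim-values contains a single run of 3s. *)
Require Import Defs.
From mathcomp Require Import all_boot zify.

Set Implicit Arguments.
Unset Strict Implicit.
Unset Printing Implicit Defensive.

(** * Nim-values characterised by the mex rule *)

Lemma mexE (s : seq nat) m :
  m \notin s -> (forall u, u < m -> u \in s) -> mex s = m.
Proof.
move=> m_notin below_m; have [mex_notin below_mex] := mexP s.
case: (ltngtP (mex s) m) => // [/below_m|/below_mex].
  by rewrite (negbTE mex_notin).
by rewrite (negbTE m_notin).
Qed.

(** Strong induction: the mex rule determines all values. The first condition is phrased with
    [n + s], so that the same shift lemmas later serve the expansion as well. *)
Lemma grundy_unique S F : all (leq 1) S ->
    (forall n s, s \in S -> F (n + s) <> F n) ->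
    (forall n u, u < F n -> exists s m, [/\ s \in S, n = m + s & F m = u]) ->
  forall n, grundy S n = F n.
Proof.
move=> S_gt0 F_neq F_reach n; elim/ltn_ind: n => n IHn.
have S_pos s : s \in S -> 0 < s by move/(allP S_gt0).
rewrite grundyE //; apply: mexE => [|u /F_reach[s [m [sS n_eq Fm]]]].
  apply/negP=> /mapP[s]; rewrite mem_filter => /andP[le_sn sS].
  rewrite IHn; last by have := S_pos s sS; lia.
  by have := F_neq (n - s) s sS; rewrite subnK.
apply/mapP; exists s; first by rewrite mem_filter sS n_eq leq_addl.
by rewrite IHn n_eq ?addnK //; have := S_pos s sS; lia.
Qed.

(** * Letters of repeated blocks *)

Lemma size_wpow w m : size (wpow w m) = m * size w.
Proof. by elim: m => //= m IHm; rewrite size_cat IHm mulSn. Qed.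

Lemma nth_wpow w m i j : i < m -> j < size w ->
  nth 0 (wpow w m) (i * size w + j) = nth 0 w j.
Proof.
elim: m i => // m IHm [|i] lt_im lt_j; rewrite nth_cat ?mul0n ?lt_j //.
by rewrite mulSn -addnA ltnNge leq_addr addKn IHm.
Qed.

Lemma nth_stripes a m q t : q < m.*2 -> t < a ->
  nth 0 (wpow (nseq a 0 ++ nseq a 1) m) (q * a + t) = odd q.
Proof.
move=> lt_q lt_t; have sz : size (nseq a 0 ++ nseq a 1) = a.*2.
  by rewrite size_cat !size_nseq addnn.
have -> : q * a + t = q./2 * a.*2 + (odd q * a + t).
  by rewrite -{1}(odd_double_half q) mulnDl; lia.
rewrite -sz nth_wpow ?sz; [|lia|case: (odd q); lia].
by rewrite nth_cat !nth_nseq size_nseq; case: (odd q); do ! case: ifP; lia.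
Qed.

(* The value at (h, q, t), for q <= k + 2 (and t < r when q = k + 2). *)
Definition cell (k r : nat) (h : bool) (q t : nat) : nat :=
  if odd k then
    if h then
      if q < k then (~~ odd q : nat)
      else if q == k then if t < r then 2 else 0
      else if q == k.+1 then if t < r then 3 else 1
      else 2
    else if q <= k then (odd q : nat)
    else if (q == k.+1) && (t < r) then 2 else 0
  else
    if h then
      if q < k.-1 then (~~ odd q : nat)
      else if q == k.-1 then if t < r then 0 else 2
      else if q == k then if t < r then 1 else 3
      else if q == k.+1 then if t < r then 0 else 2
      else 1
    else if q < k then (odd q : nat)
    else if q == k then if t < r then 0 else 2
    else if (q == k.+1) && (t < r) then 1 else 0.

(** * Values of [cell] column by column, for both parities of [k] *)

Section CellValues.

Variables k r : nat.

Lemma cellF_lt q t : q < k -> cell k r false q t = odd q.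
Proof. by move=> lt_qk; rewrite /cell lt_qk (ltnW lt_qk); case: (odd k). Qed.

Lemma cellF_k t :
  cell k r false k t = if odd k then 1 else if t < r then 0 else 2.
Proof. by rewrite /cell leqnn ltnn eqxx; case: (odd k). Qed.

Lemma cellF_k1 t :
  cell k r false k.+1 t = if odd k then if t < r then 2 else 0
                          else if t < r then 1 else 0.
Proof.
rewrite /cell ltnn eqxx (_ : (k.+1 < k) = false); last by lia.
by rewrite (_ : (k.+1 == k) = false); last by lia.
Qed.

Lemma cellF_k2 t : cell k r false k.+2 t = 0.
Proof.
rewrite /cell (_ : (k.+2 <= k) = false); last by lia.
rewrite (_ : (k.+2 < k) = false); last by lia.
rewrite (_ : (k.+2 == k.+1) = false); last by lia.
by rewrite (_ : (k.+2 == k) = false) ?if_same //; lia.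
Qed.

(** The stripes are inverted here because the second copy of the squared block starts [a] positions
    before the odd half. The bound [k.-1] suits both parities of [k]. *)
Lemma cellT_lt q t : q < k.-1 -> cell k r true q t = ~~ odd q.
Proof.
move=> lt_q; rewrite /cell lt_q (_ : q < k); last by lia.
by case: (odd k).
Qed.

Lemma cellT_k_1 t : 0 < k ->
  cell k r true k.-1 t = if odd k then 1 else if t < r then 0 else 2.
Proof.
move=> k_gt0; rewrite /cell ltnn eqxx (_ : k.-1 < k); last by lia.
by rewrite (_ : odd k.-1 = ~~ odd k); [case: (odd k) | lia].
Qed.

Lemma cellT_k t : 0 < k ->
  cell k r true k t = if odd k then if t < r then 2 else 0
                      else if t < r then 1 else 3.
Proof.
move=> k_gt0; rewrite /cell ltnn eqxx (_ : (k < k.-1) = false); last by lia.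
by rewrite (_ : (k == k.-1) = false); last by lia.
Qed.

Lemma cellT_k1 t :
  cell k r true k.+1 t = if odd k then if t < r then 3 else 1
                         else if t < r then 0 else 2.
Proof.
rewrite /cell eqxx (_ : (k.+1 < k) = false); last by lia.
rewrite (_ : (k.+1 < k.-1) = false); last by lia.
rewrite (_ : (k.+1 == k.-1) = false); last by lia.
by rewrite (_ : (k.+1 == k) = false); last by lia.
Qed.

Lemma cellT_k2 t : cell k r true k.+2 t = if odd k then 2 else 1.
Proof. by rewrite /cell; case: (odd k); rewrite !ifF //; lia. Qed.

End CellValues.

(** * Coordinates [(h, q, t)] on pile sizes *)

Section Game.

Variables a k r : nat.
Hypotheses (r_gt0 : 0 < r) (lt_ra : r < a) (k_ge3 : 3 <= k).

Let k_gt0 : 0 < k := ltnW (ltnW k_ge3).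

Let M := (k + 2) * a + r.

(** The last column [q = k + 2] is cut off after [r] positions, as [M = (k + 2) * a + r]. *)
Definition in_half q t :=
  [&& t < a, q <= k.+2 & (q == k.+2) ==> (t < r)].

Definition nim n := cell k r (odd (n %/ M)) (n %% M %/ a) (n %% M %% a).

Lemma coords n :
  exists h q t, n = h * M + q * a + t /\ in_half q t.
Proof.
have M_gt0 : 0 < M by rewrite /M; lia.
exists (n %/ M), (n %% M %/ a), (n %% M %% a).
rewrite -addnA -!divn_eq; split=> //; rewrite /in_half ltn_pmod ?(leq_trans _ lt_ra) //=.
have lt_nM := ltn_pmod n M_gt0.
have := divn_eq (n %% M) a; have := lt_nM; rewrite {2}/M.
set q := _ %/ a; set t := _ %% a => lt_n n_eq.
have le_q : q <= k.+2.
  have : q * a < k.+3 * a by rewrite mulSn; lia.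
  by rewrite ltn_mul2r => /andP[].
rewrite le_q; apply/implyP=> /eqP q_eq; rewrite q_eq in n_eq; lia.
Qed.

Lemma in_half_lt q t : in_half q t -> q * a + t < M.
Proof.
case/and3P=> lt_t le_q /implyP last_q; rewrite /M.
case: (eqVneq q k.+2) => [q_eq | neq_q].
  by have := last_q; rewrite q_eq eqxx => /(_ isT); lia.
have : q * a <= k.+1 * a by rewrite leq_mul2r; lia.
lia.
Qed.

(** The bounds [q * a + t < M] and [t < a] make the coordinates the successive quotients and
    remainders, hence unique. *)
Lemma nimE h q t : in_half q t -> nim (h * M + q * a + t) = cell k r (odd h) q t.
Proof.
move=> hqt; have lt_M := in_half_lt hqt; case/and3P: hqt => lt_t _ _.
have M_gt0 : 0 < M by lia.
have a_gt0 : 0 < a by lia.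
rewrite /nim -addnA divnMDl // modnMDl (divn_small lt_M) (modn_small lt_M) addn0.
by rewrite divnMDl // modnMDl (divn_small lt_t) (modn_small lt_t) addn0.
Qed.

Ltac cells h :=
  generalize (odd h); case; rewrite ?/cell ?/in_half ?leq0n; do ? case: ifP; lia.

(** * Periodicity, and shifts that never preserve a value *)

Lemma nim_addM2 n : nim (n + 2 * M) = nim n.
Proof.
have [h [q [t [-> hqt]]]] := coords n.
rewrite (_ : _ + _ = (h + 2) * M + q * a + t); last lia.
by rewrite !nimE // oddD addbF.
Qed.

Lemma nim_addMmul n m : nim (n + m * (2 * M)) = nim n.
Proof. by elim: m => [|m IHm]; rewrite ?addn0 // mulSnr addnA nim_addM2. Qed.

(** The shift keeps [q] and [t] and switches halves, and the two halves disagree in every cell. *)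
Lemma nim_addM n : nim (n + M) <> nim n.
Proof.
have [h [q [t [-> hqt]]]] := coords n.
rewrite (_ : _ + _ = (h + 1) * M + q * a + t); last lia.
rewrite !nimE // oddD addbT; move: hqt.
cells h.
Qed.

Lemma nim_shift_neq n m h q t h' q' t' :
    n = h * M + q * a + t -> in_half q t ->
    m = h' * M + q' * a + t' -> in_half q' t' ->
    cell k r (odd h') q' t' <> cell k r (odd h) q t ->
  nim m <> nim n.
Proof. by move=> -> ? -> ?; rewrite !nimE. Qed.

(** The shift goes one column to the right. It leaves the half only from its last [a] positions, and
    then enters column 0 of the next half, with [t] reduced by [r] modulo [a]. *)
Lemma nim_adda n : nim (n + a) <> nim n.
Proof.
have [h [q [t [n_eq hqt]]]] := coords n.
have [lt_q | [q_eq ge_t] | [q_eq lt_t]] :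
    [\/ q.+1 < k.+2 \/ q.+1 = k.+2 /\ t < r, q.+1 = k.+2 /\ r <= t | q = k.+2 /\ t < r].
- case: (ltngtP q k.+1) => ?; first by constructor 1; left.
    by constructor 3; move: hqt; rewrite /in_half; lia.
  by case: (ltnP t r) => ?; [constructor 1; right | constructor 2]; split=> //; lia.
- apply: (nim_shift_neq (h' := h) (q' := q.+1) (t' := t) n_eq hqt); [lia|..];
    move: hqt lt_q; clear n_eq; cells h.
- have {}q_eq : q = k.+1 by lia.
  apply: (nim_shift_neq (h' := h.+1) (q' := 0) (t' := t - r) n_eq hqt);
    [rewrite n_eq q_eq /M; lia|..];
    move: hqt q_eq ge_t; clear n_eq; rewrite /=; cells h.
- apply: (nim_shift_neq (h' := h.+1) (q' := 0) (t' := t + a - r) n_eq hqt);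
    [rewrite n_eq q_eq /M; lia|..];
    move: hqt q_eq lt_t; clear n_eq; rewrite /=; cells h.
Qed.

Lemma nim_addMB2a n : nim (n + (k * a + r)) <> nim n.
Proof.
have [h [q [t [n_eq hqt]]]] := coords n.
(* The shift is [M - 2 * a]: two columns back in the next half if there is room, otherwise [k]
   columns forward in the same half, where adding [r] to [t] may carry. *)
case: (ltnP 1 q) => [gt_q | le_q].
  have [q' q_eq] : exists q', q = q'.+2 by exists q.-2; lia.
  apply: (nim_shift_neq (h' := h.+1) (q' := q') (t' := t) n_eq hqt);
    [rewrite n_eq q_eq /M; lia|..];
    move: hqt q_eq; clear n_eq; rewrite /=; cells h.
case: (ltnP (t + r) a) => [lt_t | ge_t].
  apply: (nim_shift_neq (h' := h) (q' := k + q) (t' := t + r) n_eq hqt);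
    [lia|..];
    move: hqt le_q lt_t; clear n_eq; rewrite /=; cells h.
apply: (nim_shift_neq (h' := h) (q' := (k + q).+1) (t' := t + r - a) n_eq hqt);
  [lia|..];
  move: hqt le_q ge_t; clear n_eq; rewrite /=; cells h.
Qed.

Lemma nim_addMD2a n : nim (n + ((k + 4) * a + r)) <> nim n.
Proof.
(* The two long moves add up to the period [2 * M], so each is the negative of the other. *)
move=> eq_n; apply: (@nim_addMB2a (n + ((k + 4) * a + r))).
by rewrite eq_n -[RHS]nim_addM2; congr nim; rewrite /M; lia.
Qed.

(** * Every smaller value is reached by a move *)

Lemma reach_by s h q t h' q' t' u :
    s \in [:: a; k * a + r; (k + 4) * a + r] ->
    h * M + q * a + t = h' * M + q' * a + t' + s ->
    in_half q' t' -> cell k r (odd h') q' t' = u ->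
  exists s m, [/\ s \in [:: a; k * a + r; (k + 4) * a + r],
                  h * M + q * a + t = m + s & nim m = u].
Proof. by move=> sS n_eq hqt' cu; exists s, (h' * M + q' * a + t'); rewrite nimE. Qed.

Lemma reach_by_a h q t u : in_half q t -> 0 < q -> cell k r (odd h) q.-1 t = u ->
  exists s m, [/\ s \in [:: a; k * a + r; (k + 4) * a + r],
                  h * M + q * a + t = m + s & nim m = u].
Proof.
move=> hqt q_gt0; apply: (reach_by (s := a)); first by rewrite inE eqxx.
  by rewrite -{1}(prednK q_gt0) mulSn; lia.
by move: hqt; rewrite /in_half; lia.
Qed.

(** As [h] may be 0, all options must stay in the same half. The left neighbour supplies the value
    just below the current one; a 2 gets its 0 from column 0 through [k * a + r]. *)
Lemma reach_even_half h q t u :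
    ~~ odd h -> in_half q t -> u < cell k r false q t ->
  exists s m, [/\ s \in [:: a; k * a + r; (k + 4) * a + r],
                  h * M + q * a + t = m + s & nim m = u].
Proof.
move=> /negbTE hE hqt; have s2S : k * a + r \in [:: a; k * a + r; (k + 4) * a + r].
  by rewrite !inE eqxx orbT.
have by_a := @reach_by_a h q t u hqt; rewrite hE in by_a.
case/and3P: hqt => lt_t le_q /implyP last_q.
have [lt_qk | gt_qk | q_eq] := ltngtP q k.
- rewrite cellF_lt // => lt_u.
  have [q_odd u0] : odd q /\ u = 0 by move: lt_u; case: (odd q) => //; lia.
  by apply: by_a; rewrite ?cellF_lt ?u0; lia.
- have [q_eq | q_eq] : q = k.+1 \/ q = k.+2 by lia.
    rewrite q_eq cellF_k1; rewrite q_eq /= cellF_k in by_a.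
    case: ifP => k_odd; case: (ltnP t r) => // lt_tr; rewrite k_odd ?lt_tr in by_a.
      case: u by_a => [|[|//]] by_a _; last exact: by_a.
      apply: (reach_by s2S (h' := h) (q' := 0) (t' := a + t - r)).
      + by rewrite mulSn; lia.
      + by rewrite /in_half; lia.
      + by rewrite hE cellF_lt //; lia.
    by case: u by_a => // by_a _; apply: by_a.
  by rewrite q_eq cellF_k2.
rewrite q_eq cellF_k; rewrite q_eq cellF_lt in by_a; last by lia.
case: ifP => k_odd.
  by case: u by_a => // by_a _; apply: by_a; lia.
case: (ltnP t r) => // ge_tr; case: u by_a => [|[|//]] by_a _; last by apply: by_a; lia.
apply: (reach_by s2S (h' := h) (q' := 0) (t' := t - r)).
+ by lia.
+ by rewrite /in_half; lia.
+ by rewrite hE cellF_lt //; lia.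
Qed.

(** Writing the half as [h.+1] provides an even half before it. There [(k + 4) * a + r] lands two
    columns to the left, and [k * a + r] two columns to the right, or in the first two columns of
    the odd half itself when that overflows. *)
Lemma reach_odd_half h q t u :
    ~~ odd h -> in_half q t -> u < cell k r true q t ->
  exists s m, [/\ s \in [:: a; k * a + r; (k + 4) * a + r],
                  h.+1 * M + q * a + t = m + s & nim m = u].
Proof.
move=> /negbTE hE hqt.
have hE1 : odd h.+1 = true by rewrite /= hE.
have s1S : a \in [:: a; k * a + r; (k + 4) * a + r] by rewrite inE eqxx.
have s2S : k * a + r \in [:: a; k * a + r; (k + 4) * a + r].
  by rewrite !inE eqxx orbT.
have s3S : (k + 4) * a + r \in [:: a; k * a + r; (k + 4) * a + r].
  by rewrite !inE eqxx !orbT.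
have M_def : M = k * a + a + a + r by rewrite /M; lia.
have by_a := @reach_by_a h.+1 q t u hqt; rewrite hE1 in by_a.
case/and3P: hqt => lt_t le_q /implyP last_q.
have [lt_qk | gt_qk | q_eq] := ltngtP q k.-1.
- rewrite cellT_lt // => lt_u.
  have [/negbTE q_even u0] : ~~ odd q /\ u = 0 by move: lt_u; case: (odd q) => //; lia.
  (* Column 0 has no left neighbour in its half: removing [a] leads to the last [a] positions of the
     even half, which are all 0. *)
  case: (posnP q) => [q0 | q_gt0]; last first.
    by apply: by_a; rewrite ?cellT_lt ?u0; lia.
  rewrite q0 u0; case: (ltnP (t + r) a) => lt_tr.
    apply: (reach_by s1S (h' := h) (q' := k.+1) (t' := t + r)).
    + by lia.
    + by rewrite /in_half; lia.
    + by rewrite hE cellF_k1 ltnNge leq_addl if_same.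
  apply: (reach_by s1S (h' := h) (q' := k.+2) (t' := t + r - a)).
  + by lia.
  + by rewrite /in_half; lia.
  + by rewrite hE cellF_k2.
- have [q_eq | [q_eq | q_eq]] : q = k \/ q = k.+1 \/ q = k.+2 by lia.
  + rewrite q_eq cellT_k; rewrite q_eq cellT_k_1 // in by_a.
    case: ifP => k_odd; case: (ltnP t r) => // lt_tr;
      rewrite k_odd ?lt_tr ?[t < r]ltnNge ?lt_tr /= in by_a.
    * case: u by_a => [|[|//]] by_a _; last by apply: by_a; lia.
      apply: (reach_by s2S (h' := h) (q' := k.+2) (t' := t)).
      - by lia.
      - by rewrite /in_half; lia.
      - by rewrite hE cellF_k2.
    * by case: u by_a => // by_a _; apply: by_a; rewrite ?lt_tr; lia.
    (* A 3 needs all three moves: [a] gives 2, and the two long moves give 0 and 1. *)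
    * case: u by_a => [|[|[|//]]] by_a _; last by apply: by_a; lia.
        have k2 : k * a = (k - 2) * a + 2 * a by rewrite -mulnDl; congr muln; lia.
        apply: (reach_by s3S (h' := h) (q' := k - 2) (t' := t)).
        - by lia.
        - by rewrite /in_half; lia.
        - by rewrite hE cellF_lt; lia.
      apply: (reach_by s2S (h' := h.+1) (q' := 0) (t' := t - r)).
      - by lia.
      - by rewrite /in_half; lia.
      - by rewrite hE1 cellT_lt; lia.
  + rewrite q_eq cellT_k1; rewrite q_eq /= cellT_k // in by_a.
    have k1 : k * a = k.-1 * a + a by rewrite -mulSnr prednK //; lia.
    case: ifP => k_odd; case: (ltnP t r) => // lt_tr;
      rewrite k_odd ?lt_tr ?[t < r]ltnNge ?lt_tr /= in by_a.
    * case: u by_a => [|[|[|//]]] by_a _; last by apply: by_a; rewrite ?lt_tr.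
        apply: (reach_by s3S (h' := h) (q' := k.-1) (t' := t)).
        - by lia.
        - by rewrite /in_half; lia.
        - by rewrite hE cellF_lt; lia.
      apply: (reach_by s2S (h' := h.+1) (q' := 0) (t' := t + a - r)).
      - by lia.
      - by rewrite /in_half; lia.
      - by rewrite hE1 cellT_lt; lia.
    * by case: u by_a => // by_a _; apply: by_a.
    (* The left neighbour of this 2 is a 3, so both 0 and 1 come from the long moves. *)
    * case: u {by_a} => [|[|//]] _.
        apply: (reach_by s2S (h' := h.+1) (q' := 1) (t' := t - r)).
        - by lia.
        - by rewrite /in_half; lia.
        - by rewrite hE1 cellT_lt; lia.
      apply: (reach_by s3S (h' := h) (q' := k.-1) (t' := t)).
      - by lia.
      - by rewrite /in_half; lia.
      - by rewrite hE cellF_lt; lia.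
  + have lt_tr : t < r by apply: last_q; rewrite q_eq.
    rewrite q_eq cellT_k2; rewrite q_eq /= cellT_k1 lt_tr in by_a.
    case: ifP => k_odd; rewrite k_odd in by_a.
      case: u {by_a} => [|[|//]] _.
        apply: (reach_by s2S (h' := h.+1) (q' := 1) (t' := t + a - r)).
        - by lia.
        - by rewrite /in_half; lia.
        - by rewrite hE1 cellT_lt; lia.
      apply: (reach_by s3S (h' := h) (q' := k) (t' := t)).
      - by lia.
      - by rewrite /in_half; lia.
      - by rewrite hE cellF_k k_odd.
    by case: u by_a => // by_a _; apply: by_a.
have k1 : k * a = k.-1 * a + a by rewrite -mulSnr prednK //; lia.
rewrite q_eq cellT_k_1 //; rewrite q_eq cellT_lt in by_a; last by lia.
case: ifP => k_odd.
  by case: u by_a => // by_a _; apply: by_a; lia.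
case: (ltnP t r) => // ge_tr; case: u by_a => [|[|//]] by_a _; last by apply: by_a; lia.
apply: (reach_by s2S (h' := h) (q' := k.+1) (t' := t)).
+ by lia.
+ by rewrite /in_half; lia.
+ by rewrite hE cellF_k1 ltnNge ge_tr k_odd.
Qed.

Lemma nim_reach n u : u < nim n ->
  exists s m, [/\ s \in [:: a; k * a + r; (k + 4) * a + r], n = m + s & nim m = u].
Proof.
have [h [q [t [-> hqt]]]] := coords n; rewrite nimE //.
case hE: (odd h); last by apply: reach_even_half; rewrite ?hE.
by case: h hE => // h hE; apply: reach_odd_half.
Qed.

(** * Least period *)

Lemma start_of_threes n : nim n.+1 = 3 -> nim n <> 3 ->
  exists h, odd h /\ n.+1 = h * M + (if odd k then k.+1 * a else k * a + r).
Proof.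
have [h [q [t [n_eq hqt]]]] := coords n.+1.
rewrite n_eq nimE // => three not_three.
have [hE [qE tE]] : odd h /\ q = (if odd k then k.+1 else k) /\ (odd k || (r <= t)).
  by move: three; cells h.
exists h; split=> //.
(* This is the offset within the run of 3s; if it is positive, [n] lies in the same run. *)
case: (posnP (if odd k then t else t - r)) => t0.
  by rewrite qE; move: t0 tE; case: ifP => //=; lia.
have t_gt0 : 0 < t by move: t0; case: ifP; lia.
case: not_three; rewrite (_ : n = h * M + q * a + t.-1); last by lia.
by rewrite nimE //; move: hqt three t0; cells h.
Qed.

Lemma nim_least_period : is_least_period nim (2 * M).
Proof.
have M_gt0 : 0 < M by rewrite /M; lia.
split=> [|q [q_gt0 nim_q]]; first by split; [lia | exact: nim_addM2].
pose c := if odd k then k.+1 * a else k * a + r.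
have c_gt0 : 0 < c by rewrite /c; do ? case: ifP; lia.
have three : nim (M + c) = 3.
  rewrite (_ : M + c = 1 * M + (if odd k then k.+1 else k) * a + (if odd k then 0 else r)).
    by rewrite nimE ?/in_half ?/cell; do ? case: ifP; lia.
  by rewrite /c; do ? case: ifP; lia.
have not_three : nim (M + c.-1) <> 3.
  rewrite (_ : M + c.-1 =
    1 * M + k * a + (if odd k then a.-1 else r.-1)).
    by rewrite nimE ?/in_half ?/cell; do ? case: ifP; lia.
  by move: c_gt0; rewrite /c; do ? case: ifP; lia.
(* A period [q] carries the start [M + c] of a run to the start [M + c + q] of another. *)
have [||h [h_odd]] := @start_of_threes (M + c.-1 + q).
- by rewrite -three -(nim_q (M + c)); congr nim; lia.
- by rewrite nim_q.
(* Here [h] is odd, and [h = 1] would give [q = 0]; so [h] is at least 3 and [q] at least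
   [2 * M]. *)
rewrite -/c; case: h h_odd => [|[|[|h]]] //= _; rewrite ?mulSn; lia.
Qed.

(** * The expansion *)

(** Writing [s = x * a + y], the start [n = 0] works whenever [s] has value 0. The other cases use
    pairs of 0s, or of 1s, at explicit positions. *)
Lemma nim_collision s : 0 < s <= M -> s != a -> s != k * a + r -> s != M ->
  exists n, nim (n + s) = nim n.
Proof.
move=> /andP[s_gt0 le_sM] s_neq_a s_neq_b s_neq_M.
have [h [x [y [s_eq hxy]]]] := coords s.
have h0 : h = 0 by case: h s_eq => // h; rewrite mulSn; lia.
rewrite h0 /= in s_eq.
have via h1 q t h' q' t' :
    h1 * M + q * a + t + s = h' * M + q' * a + t' ->
    in_half q t -> in_half q' t' -> cell k r (odd h') q' t' = cell k r (odd h1) q t ->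
    exists n, nim (n + s) = nim n.
  by move=> n_eq *; exists (h1 * M + q * a + t); rewrite n_eq !nimE.
have from0 x' y' q t : x * a + y + q * a + t = x' * a + y' ->
    in_half q t -> in_half x' y' -> cell k r false x' y' = cell k r false q t ->
    exists n, nim (n + s) = nim n.
  by move=> n_eq; apply: (via 0 q t 0 x' y'); rewrite s_eq; lia.
have x_neq1 : y = 0 -> x != 1.
  by move=> y0; apply: contra s_neq_a => /eqP x1; rewrite s_eq y0 x1; lia.
have x_neqk : y = r -> x != k.
  by move=> yr; apply: contra s_neq_b => /eqP xk; rewrite s_eq yr xk; lia.
have x_gt0 : y = 0 -> 0 < x by move: s_gt0; rewrite s_eq; case: (x) => //; lia.
have c00 : cell k r false 0 0 = 0 by rewrite cellF_lt //; lia.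
have h00 : in_half 0 0 by rewrite /in_half; lia.
have by_zero : cell k r false x y = 0 -> exists n, nim (n + s) = nim n.
  by move=> c0; apply: (from0 x y 0 0) => //; rewrite ?addn0 // c0.
case/and3P: (hxy) => lt_y le_x /implyP last_x.
have by_one : odd k -> odd x -> 2 < x <= k -> y < r ->
    exists n, nim (n + s) = nim n.
  move=> k_odd x_odd le_x_k lt_yr.
  have x_eq : x * a = 3 * a + (x - 3) * a by rewrite -mulnDl; congr muln; lia.
  (* Both ends carry 1: [n = k * a] lies in the last striped column, and [n + s] in an even column
     of the odd half. *)
  apply: (via 0 k 0 1 (x - 3) (a - r + y)).
  - by rewrite s_eq /M; lia.
  - by rewrite /in_half; lia.
  - by rewrite /in_half; lia.
  - by rewrite cellF_k k_odd cellT_lt; lia.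
(* Position [(k + 1) * a + r] has value 0 for either parity of [k], so any 0 at distance [s] before
   it gives a collision. *)
have by_k1 q t : x * a + y + q * a + t = k.+1 * a + r -> q < k -> ~~ odd q -> t < a ->
    exists n, nim (n + s) = nim n.
  move=> n_eq lt_qk q_even lt_t; apply: (from0 k.+1 r q t) => //.
  - by rewrite /in_half; lia.
  - by rewrite /in_half; lia.
  - by rewrite cellF_k1 ltnn if_same cellF_lt // (negbTE q_even).
clear s_gt0 le_sM s_neq_a s_neq_b s_neq_M hxy h0 s_eq.
have [lt_xk | gt_xk | x_eq] := ltngtP x k.
- case: (boolP (odd x)) => x_odd; last by apply: by_zero; rewrite cellF_lt // (negbTE x_odd).
  have [y0 | y_gt0] := posnP y; last first.
    (* Starting from [a - y], a 0 in column 0, rounds [s] up to the start of the even column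
       [x + 1]. *)
    apply: (from0 x.+1 0 0 (a - y)).
    + by lia.
    + by rewrite /in_half; lia.
    + by rewrite /in_half; lia.
    have [lt_x1 | x1] : x.+1 < k \/ x.+1 = k by lia.
      by rewrite !cellF_lt /= ?x_odd //; lia.
    have k_even : odd k = false by lia.
    by rewrite x1 cellF_k k_even r_gt0 cellF_lt.
  have x_gt2 : 2 < x by have := x_neq1 y0; lia.
  case: (boolP (odd k)) => k_odd; first by apply: by_one; lia.
  have x_eq : k.+1 * a = x * a + (k.+1 - x) * a by rewrite -mulnDl; congr muln; lia.
  by apply: (by_k1 (k.+1 - x) r); lia.
- have [x_eq | x_eq] : x = k.+1 \/ x = k.+2 by lia.
    case: (ltnP y r) => lt_yr; first by apply: (by_k1 0 (r - y)); rewrite ?x_eq; lia.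
    by apply: by_zero; rewrite x_eq cellF_k1 ltnNge lt_yr if_same.
  by apply: by_zero; rewrite x_eq cellF_k2.
have [lt_yr | gt_yr | y_eq] := ltngtP y r.
- case: (boolP (odd k)) => k_odd; first by apply: by_one; lia.
  by apply: by_zero; rewrite x_eq cellF_k (negbTE k_odd) lt_yr.
- by apply: (by_k1 0 (a + r - y)); rewrite ?x_eq; lia.
- by have := x_neqk y_eq; rewrite x_eq eqxx.
Qed.

Lemma nim_expansion s :
  (0 < s /\ forall n, nim (n + s) <> nim n) <->
  star (fun x => x \in [:: a; k * a + r; (k + 2) * a + r; (k + 4) * a + r;
                            (2 * k + 3) * a + 2 * r]) (2 * M) s.
Proof.
have M_gt : 2 * a < M by rewrite /M; have := leq_mul2r a 3 k; lia.
split=> [[s_gt0 s_neq] | [x [m [x_in ->]]]]; last first.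
  split=> [|n]; first by move: x_in; rewrite !inE; lia.
  rewrite addnA nim_addMmul; move: x_in; rewrite !inE.
  case/or4P=> [/eqP-> | /eqP-> | /eqP-> | /orP[] /eqP->].
  - exact: nim_adda.
  - exact: nim_addMB2a.
  - exact: nim_addM.
  - exact: nim_addMD2a.
  (* This element is [-a] modulo the period. *)
  - have -> : (2 * k + 3) * a + 2 * r = 2 * M - a by rewrite /M; lia.
    move=> eq_n; apply: (@nim_adda (n + (2 * M - a))).
    by rewrite eq_n -[RHS]nim_addM2; congr nim; lia.
have s_eq := divn_eq s (2 * M).
have lt_s : s %% (2 * M) < 2 * M by rewrite ltn_pmod //; lia.
exists (s %% (2 * M)), (s %/ (2 * M)); split; last by rewrite addnC.
move: (s %/ _) (s %% _) s_eq lt_s => m x s_eq lt_x.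
have {}s_neq n : nim (n + x) <> nim n.
  by rewrite -(nim_addMmul (n + x) m) -addnA (addnC x) -s_eq; apply: s_neq.
have x_gt0 : 0 < x by case: (posnP x) => // x0; case: (s_neq 0); rewrite x0.
rewrite !inE; apply/negPn/negP=> x_notin.
have [le_xM | lt_Mx] := leqP x M.
  by have [| | | |n /s_neq] := @nim_collision x; move: x_notin; rewrite /M; lia.
(* Negation modulo [2 * M] brings [x] into the range up to [M]; the excluded shifts then correspond
   to [2 * M - a], [M + 2 * a] and [M]. *)
have [| | | |n eq_n] := @nim_collision (2 * M - x).
- lia.
- by move: x_notin; rewrite /M; lia.
- by move: x_notin; rewrite /M; lia.
- lia.
case: (s_neq (n + (2 * M - x))); rewrite eq_n -[RHS]nim_addM2.
by congr nim; lia.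
Qed.

(** * The nim-sequence as a word *)

Definition word : seq nat :=
  if odd k then
    wpow (wpow (nseq a 0 ++ nseq a 1) ((k + 1) %/ 2) ++ nseq r 2) 2
      ++ nseq (a - r) 0 ++ nseq r 3 ++ nseq (a - r) 1 ++ nseq r 2
  else
    wpow (wpow (nseq a 0 ++ nseq a 1) (k %/ 2)
            ++ nseq r 0 ++ nseq (a - r) 2 ++ nseq r 1) 2
      ++ nseq (a - r) 3 ++ nseq r 0 ++ nseq (a - r) 2 ++ nseq r 1.

(** This is the squared block. Its length is [M - a], not [M], so its second copy begins inside the
    even half. *)
Definition core : seq nat :=
  if odd k then wpow (nseq a 0 ++ nseq a 1) ((k + 1) %/ 2) ++ nseq r 2
  else wpow (nseq a 0 ++ nseq a 1) (k %/ 2) ++ nseq r 0 ++ nseq (a - r) 2 ++ nseq r 1.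

Definition tail : seq nat :=
  if odd k then nseq (a - r) 0 ++ nseq r 3 ++ nseq (a - r) 1 ++ nseq r 2
  else nseq (a - r) 3 ++ nseq r 0 ++ nseq (a - r) 2 ++ nseq r 1.

Lemma size_stripes m : size (wpow (nseq a 0 ++ nseq a 1) m) = m.*2 * a.
Proof. by rewrite size_wpow size_cat !size_nseq; lia. Qed.

Lemma size_core : size core = M - a.
Proof.
rewrite /core /M; case: ifP => k_odd; rewrite !size_cat !size_nseq size_stripes.
  by rewrite (_ : ((k + 1) %/ 2).*2 = k.+1); lia.
by rewrite (_ : (k %/ 2).*2 = k); lia.
Qed.

Lemma size_tail : size tail = 2 * a.
Proof. by rewrite /tail; case: ifP; rewrite !size_cat !size_nseq; lia. Qed.

Lemma nth_core q t : t < a -> q < k.+1 \/ q = k.+1 /\ t < r ->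
  nth 0 core (q * a + t) = cell k r false q t.
Proof.
move=> lt_t le_q; rewrite /core; case: ifP => k_odd; rewrite nth_cat size_stripes.
  rewrite (_ : ((k + 1) %/ 2).*2 = k.+1); last lia.
  case: le_q => [lt_q | [q_eq lt_tr]].
    rewrite ifT; last by have := leq_mul2r a q.+1 k.+1; rewrite mulSn; lia.
    by rewrite nth_stripes ?/cell ?k_odd; do ? case: ifP; lia.
  rewrite q_eq ifF; last lia.
  by rewrite nth_nseq /cell; do ? case: ifP; lia.
rewrite (_ : (k %/ 2).*2 = k); last lia.
case: (ltnP q k) => [lt_q | ge_q].
  rewrite ifT; last by have := leq_mul2r a q.+1 k; rewrite mulSn; lia.
  by rewrite nth_stripes ?/cell ?k_odd; do ? case: ifP; lia.
have [e q_eq] : exists e, q = k + e by exists (q - k); lia.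
rewrite ifF ?q_eq; last by lia.
rewrite (_ : (k + e) * a + t - k * a = e * a + t); last by lia.
have e_eq : e = 0 \/ e = 1 /\ t < r by lia.
rewrite !nth_cat !nth_nseq !size_nseq /cell.
by case: e_eq => [-> | [-> lt_tr]]; do ? case: ifP; lia.
Qed.

(** The tail fills the last [2 * a] positions of the period, hence starts at offset [k * a + r] of
    the odd half. *)
Lemma nth_tail q t : in_half (k + q) t -> r <= q * a + t ->
  nth 0 tail (q * a + t - r) = cell k r true (k + q) t.
Proof.
rewrite /tail /in_half => hqt ge_r; have q_cases : [\/ q = 0, q = 1 | q = 2].
  have : q < 3 by lia.
  by case: (q) => [|[|[|]]] // _; [constructor 1 | constructor 2 | constructor 3].
case: ifP => k_odd; rewrite !nth_cat !nth_nseq !size_nseq /cell k_odd;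
  case: q_cases hqt ge_r => ->; do ? case: ifP; lia.
Qed.

Lemma wordE : word = core ++ core ++ tail.
Proof. by rewrite /word /core /tail /wpow; case: ifP; rewrite /= cats0 -!catA. Qed.

Lemma size_word : size word = 2 * M.
Proof. by rewrite wordE !size_cat size_core size_tail /M; lia. Qed.

Lemma nth_word n : nth 0 word (n %% (2 * M)) = nim n.
Proof.
have [h [q [t [-> hqt]]]] := coords n; rewrite nimE //.
have lt_M := in_half_lt hqt.
have -> : h * M + q * a + t = h./2 * (2 * M) + (odd h * M + q * a + t).
  by rewrite -{1}(odd_double_half h); lia.
rewrite modnMDl modn_small; last by case: (odd h); lia.
rewrite wordE !nth_cat size_core.
have M_def : M = k.+1 * a + a + r by rewrite /M; lia.
case: (odd h); last first.
  rewrite mul0n add0n.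
  (* The first case reads the first core; the other two read the initial 0s of the second core. *)
  have [q_small | [q_eq ge_t] | [q_eq lt_t]] :
      [\/ q < k.+1 \/ q = k.+1 /\ t < r, q = k.+1 /\ r <= t | q = k.+2 /\ t < r].
  - case: (ltngtP q k.+1) => ?; first by constructor 1; left.
      by constructor 3; move: hqt; rewrite /in_half; lia.
    by case: (ltnP t r) => ?; [constructor 1; right | constructor 2].
  - rewrite ifT; first by apply: nth_core => //; move: hqt; rewrite /in_half; lia.
    case: q_small => [lt_q | [-> lt_t]]; last by lia.
    by have := leq_mul2r a q.+1 k.+1; rewrite mulSn; move: hqt; rewrite /in_half; lia.
  - rewrite ifF ?q_eq; last by lia.
    rewrite (_ : _ + t - (M - a) = 0 * a + (t - r)); last by lia.
    rewrite ifT; last by move: hqt; rewrite /in_half; lia.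
    rewrite nth_core; [|move: hqt; rewrite /in_half; lia|lia].
    by move: hqt; cells h.
  - rewrite ifF ?q_eq; last by lia.
    rewrite (_ : _ + t - (M - a) = 0 * a + (t + a - r)); last by lia.
    rewrite ifT; last by move: hqt; rewrite /in_half; lia.
    rewrite nth_core; [|move: hqt; rewrite /in_half; lia|lia].
    by move: hqt; cells h.
rewrite mul1n ifF; last by lia.
(* The odd half reads the second core one column further on, until the tail takes over. *)
rewrite (_ : _ + t - (M - a) = q.+1 * a + t); last by lia.
have [q_small | q_big] : (q < k \/ q = k /\ t < r) \/ (exists2 e, q = k + e & r <= e * a + t).
- case: (ltngtP q k) => ?; [by left; left | right | ].
    by exists (q - k); [lia | have := leq_mul2r a 1 (q - k); lia].
  by case: (ltnP t r) => ?; [left; right | right; exists 0; lia].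
- rewrite ifT.
    rewrite nth_core; [|by move: hqt; rewrite /in_half; lia|by lia].
    by move: hqt; cells h.
  case: q_small => [lt_q | [-> lt_t]]; last by lia.
  by have := leq_mul2r a q.+2 k.+1; rewrite mulSn; move: hqt; rewrite /in_half; lia.
case: q_big hqt => e -> ge_r hqt.
rewrite ifF; last by lia.
rewrite (_ : _ - (M - a) = e * a + t - r); last by lia.
exact: nth_tail.
Qed.

(** * Transfer from [nim] to the game *)

Lemma grundy_nim n : grundy [:: a; k * a + r; (k + 4) * a + r] n = nim n.
Proof.
apply: grundy_unique n => [|n s|n u]; [by rewrite /=; lia | | exact: nim_reach].
rewrite !inE => /or3P[] /eqP->.
- exact: nim_adda.
- exact: nim_addMB2a.
- exact: nim_addMD2a.
Qed.

Lemma game_periodic :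
  periodic_with [:: a; k * a + r; (k + 4) * a + r] (2 * M) word.
Proof.
have [[M_gt0 nim_per] least] := nim_least_period.
split=> [||n]; [exact: size_word | | by rewrite nth_word grundy_nim].
split=> [|q [q_gt0 q_per]]; first by split=> // n; rewrite !grundy_nim.
by apply: least; split=> // n; rewrite -!grundy_nim.
Qed.

Lemma game_expansion :
  has_expansion [:: a; k * a + r; (k + 4) * a + r]
    (star (fun x => x \in [:: a; k * a + r; (k + 2) * a + r; (k + 4) * a + r;
                              (2 * k + 3) * a + 2 * r]) (2 * M)).
Proof.
move=> s; rewrite -nim_expansion /in_expansion.
by split=> -[s_gt0 s_neq]; split=> // n; have := s_neq n; rewrite !grundy_nim.
Qed.

End Game.

Theorem theorem5p2 :
  forall a k r : nat, 0 < a -> 0 < k -> 0 < r -> r < a -> 3 <= k ->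
  let S := [:: a; k * a + r; (k + 4) * a + r] in
  let p := 2 * k * a + 4 * a + 2 * r in
  let Weven :=
    wpow (wpow (nseq a 0 ++ nseq a 1) (k %/ 2)
            ++ nseq r 0 ++ nseq (a - r) 2 ++ nseq r 1) 2
      ++ nseq (a - r) 3 ++ nseq r 0 ++ nseq (a - r) 2 ++ nseq r 1 in
  let Wodd :=
    wpow (wpow (nseq a 0 ++ nseq a 1) ((k + 1) %/ 2) ++ nseq r 2) 2
      ++ nseq (a - r) 0 ++ nseq r 3 ++ nseq (a - r) 1 ++ nseq r 2 in
  (~~ odd k -> periodic_with S p Weven) /\
  (odd k -> periodic_with S p Wodd) /\
  has_expansion S
    (star (fun x => x \in [:: a; k * a + r; (k + 2) * a + r; (k + 4) * a + r;
                              (2 * k + 3) * a + 2 * r]) p).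
Proof.
move=> a k r a_gt0 k_gt0 r_gt0 lt_ra k_ge3 S p Weven Wodd.
have p_eq : p = 2 * ((k + 2) * a + r) by rewrite /p; lia.
have := game_periodic r_gt0 lt_ra k_ge3; have := game_expansion r_gt0 lt_ra k_ge3.
rewrite -p_eq /word => expansion periodic.
split=> [/negbTE k_even | ]; first by rewrite k_even in periodic.
by split=> // k_odd; rewrite k_odd in periodic.
Qed.
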